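(* Let $\mathfrak g$ be a finite-dimensional real vector space with a lattice $\mathfrak g_{\mathbb Z}\subset\mathfrak g$. Let $\Delta\subseteq\mathfrak g^*$ be a polytope and $A\subset\mathfrak g^*$ an affine subspace with $A\cap\Delta\neq\emptyset$. (1) If $\Delta$ is simple and $A$ and $\Delta$ intersect relatively transversely, then $A\cap\Delta$ is simple. (2) If $\Delta$ is unimodular and $A$ and $\Delta$ intersect integrally transversely (in particular $A$ is a translate of a rational subspace), then $A\cap\Delta$ is unimodular.
   Context: $\mathfrak g_{\mathbb Z}^*=\{\xi\in\mathfrak g^*\mid \xi(\mathfrak g_{\mathbb Z})\subseteq\mathbb Z\}$ is the dual lattice. A polyhedron $P\subseteq\mathfrak g^*$ is a finite intersection of affine closed half-spaces $\{\xi\mid\langle\xi,v_i\rangle\ge c_i\}$, $v_i\in\mathfrak g$, $c_i\in\mathbb R$; it is rational if the $v_i$ can be taken in $\mathfrak g_{\mathbb Z}$. A polytope is a bounded polyhedron. Polytopes need not be full-dimensional. For $\xi\in P$: $C_\xi P=\mathrm{Cone}(P-\xi)$ (conic hull) is the local cone; if $F$ is the unique face of $P$ containing $\xi$ in its relative interior, $L_\xi P=\mathrm{Span}_{\mathbb R}(F-\xi)$; $\mathrm{dir}(P)$ is the linear subspace of which the affine hull of $P$ is a translate. A polyhedral cone $C$ is simple if it is the conic hull of a basis of $\mathrm{dir}(C)$, and unimodular if it is rational and the conic hull of a $\mathbb Z$-basis of $\mathfrak g_{\mathbb Z}^*\cap\mathrm{dir}(C)$. A polytope $\Delta$ is simple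 if $C_\xi\Delta$ is simple for all vertices $\xi$, and unimodular if it is rational and $C_\xi\Delta$ is unimodular for all vertices $\xi$. Let $B$ be the direction subspace of $A$. $A$ and $\Delta$ intersect relatively transversely if $B+L_\xi\Delta=B+\mathrm{dir}(\Delta)$ for all $\xi\in A\cap\Delta$. For $\Delta$ rational and $B$ rational (spanned by $B\cap\mathfrak g_{\mathbb Z}^*$), they intersect integrally transversely if for all $\xi\in A\cap\Delta$ $$(B\cap\mathfrak g_{\mathbb Z}^* )+(L_\xi\Delta\cap\mathfrak g_{\mathbb Z}^* )=(B\cap\mathfrak g_{\mathbb Z}^* )+(\mathrm{dir}(\Delta)\cap\mathfrak g_{\mathbb Z}^* ).$$ *)

(* Defs.v *)
From HB Require Import structures.
From mathcomp Require Export all_boot all_order all_algebra.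
From mathcomp Require Export all_classical all_reals all_analysis.

Set Implicit Arguments.
Unset Strict Implicit.
Unset Printing Implicit Defensive.
Export Order.TTheory GRing.Theory Num.Theory.
Export numFieldNormedType.Exports.

Local Open Scope classical_set_scope.
Local Open Scope ring_scope.

Import VectorInternalTheory.

Section Hulls.
Variables (R : realType) (E : vectType R).
Implicit Types (S F : set E) (A : set E) (B : {vspace E}) (x : E).

Definition vset B : set E := [set x | x \in B].

Definition addset S1 S2 : set E := [set (x + y : E) | x in S1 & y in S2].

Definition translate S x : set E := [set y - x | y in S].

Definition lin_hull S : set E :=
  [set x | exists n (c : 'I_n -> R) (s : 'I_n -> E),
     (forall i, S (s i)) /\ x = \sum_i c i *: s i].

Definition conic_hull S : set E :=
  [set x | exists n (c : 'I_n -> R) (s : 'I_n -> E),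
     [/\ forall i, S (s i), forall i, 0 <= c i & x = \sum_i c i *: s i]].

Definition aff_hull S : set E :=
  [set x | exists n (c : 'I_n -> R) (s : 'I_n -> E),
     [/\ forall i, S (s i), \sum_i c i = 1 & x = \sum_i c i *: s i]].

(* For nonempty S, the affine hull is a translate of its set of differences. *)
Definition dir S : set E := [set x - y | x in aff_hull S & y in aff_hull S].

Definition is_affine A B : Prop := exists a : E, A = [set x | x - a \in B].

(* The topology of E is that of the row vectors in the coordinates v2r; in    *)
(* finite dimension it does not depend on the choice of coordinates.          *)
Definition bounded S : Prop := bounded_set [set v2r x | x in S].

Definition rel_interior F : set E :=
  [set x | F x /\ \forall u \near v2r x, aff_hull F (r2v u) -> F (r2v u)].

Definition local_cone S x : set E := conic_hull (translate S x).

Definition is_Zbasis n (X : n.-tuple E) (M : set E) : Prop :=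
  M = [set x | inIntSpan X x] /\
  (forall a : 'I_n -> int, \sum_(i < n) X`_i *~ a i = 0 -> forall i, a i = 0).

End Hulls.

Section Polyhedra.
Variables (R : realType) (V : vectType R).
Local Notation W := 'Hom(V, R^o).
Variable gZ : set V.
Implicit Types (P C F A : set W) (B : {vspace W}) (xi : W).

Definition is_lattice : Prop :=
  exists (n : nat) (X : n.-tuple V),
    basis_of fullv X /\ gZ = [set v | inIntSpan X v].

Definition dual_lattice : set W :=
  [set xi | forall v, gZ v -> (xi v : R) \is a Num.int].

Definition polyhedron_over (N : set V) P : Prop :=
  exists n (v : 'I_n -> V) (c : 'I_n -> R),
    (forall i, N (v i)) /\ P = [set xi | forall i, c i <= xi (v i)].

Definition is_polyhedron P : Prop := polyhedron_over setT P.

Definition is_rational P : Prop := polyhedron_over gZ P.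

Definition is_polytope P : Prop := is_polyhedron P /\ bounded P.

(* The choice v = 0 makes P itself and the empty set faces of P. *)
Definition is_face F P : Prop :=
  exists (v : V) (c : R),
    (forall xi, P xi -> c <= xi v) /\ F = [set xi | P xi /\ xi v = c].

Definition is_vertex xi P : Prop := is_face [set xi] P.

(* The union ranges over a single face when xi lies in the polyhedron P. *)
Definition L_space xi P : set W :=
  \bigcup_(F in [set F | is_face F P /\ rel_interior F xi])
    lin_hull (translate F xi).

Definition polyhedral_cone C : Prop := is_polyhedron C /\ conic_hull C = C.

Definition simple_cone C : Prop :=
  polyhedral_cone C /\
  exists (U : {vspace W}) (X : seq W),
    [/\ dir C = vset U, basis_of U X & C = conic_hull [set x | x \in X]].

Definition unimodular_cone C : Prop :=
  [/\ polyhedral_cone C, is_rational C &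
  exists (n : nat) (X : n.-tuple W),
    is_Zbasis X (dual_lattice `&` dir C) /\
    C = conic_hull [set x | x \in X]].

Definition simple_polytope P : Prop :=
  is_polytope P /\ forall xi, is_vertex xi P -> simple_cone (local_cone P xi).

Definition unimodular_polytope P : Prop :=
  [/\ is_polytope P, is_rational P &
  forall xi, is_vertex xi P -> unimodular_cone (local_cone P xi)].

(* In both notions of transversality, B is the direction subspace of A. *)
Definition relatively_transverse A B P : Prop :=
  forall xi, (A `&` P) xi ->
    addset (vset B) (L_space xi P) = addset (vset B) (dir P).

Definition rational_subspace B : Prop :=
  vset B = lin_hull (vset B `&` dual_lattice).

Definition integrally_transverse A B P : Prop :=
  [/\ is_rational P, rational_subspace B &
  forall xi, (A `&` P) xi ->
    addset (vset B `&` dual_lattice) (L_space xi P `&` dual_lattice) =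
    addset (vset B `&` dual_lattice) (dir P `&` dual_lattice)].

End Polyhedra.

(* Main.v *)
Require Import Defs.
From mathcomp Require Import ring lra.
Import VectorInternalTheory.

Set Implicit Arguments.
Unset Strict Implicit.
Unset Printing Implicit Defensive.

Local Open Scope classical_set_scope.
Local Open Scope ring_scope.

(** Write Delta as a system of inequalities. Given a vertex eta of A /\ Delta,
    pick a vertex xi of Delta at which all inequalities tight at eta stay tight,
    and let e_1, ..., e_n generate the local cone at xi. Then L_eta Delta is
    spanned by the e_j it contains, and the local cone of Delta at eta is
    L_eta Delta plus the cone over the other e_j. Transversality gives
    e_j = b_j + l_j with b_j in B and l_j in L_eta Delta (both integral in the
    integral case). Since eta is a vertex of A /\ Delta, B meets L_eta Delta
    only in 0, so that an expansion in the e_j of a vector of B is also one in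
    the b_j: the b_j with e_j outside L_eta Delta are the required basis.
    The integral case also needs that integer matrices have the same rank and,
    up to a common denominator, the same cokernel over R as over rat: hence a
    Z-free family of the dual lattice is R-free, and A is cut out by equations
    with normals in the lattice. *)

(** * Hulls of finite families, and bounded sets *)

Section Hulls.
Variables (R : realType) (E : vectType R).
Implicit Types (S : set E) (x y : E).

(** A conic combination may use the same generator several times. Choosing an index [g k] for each
    term and adding the coefficients over each fibre of [g] leaves one coefficient per index. *)
Lemma conic_hull_tuple n (X : n.-tuple E) :
  conic_hull [set x | x \in X] =
  [set x | exists c : 'I_n -> R,
     (forall i, 0 <= c i) /\ x = \sum_i c i *: X`_i].
Proof.
apply/seteqP; split => x /=; last first.
  move=> [c [c0 ->]]; exists n, c, (fun i => X`_i); split=> // i.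
  by rewrite /= mem_nth ?size_tuple.
move=> [m [c [s [sX c0 ->]]]].
have /choice[g gP] : forall k, exists i : 'I_n, s k = X`_i.
  move=> k; have /tnthP[i sk] := sX k.
  by exists i; rewrite sk (tnth_nth 0).
exists (fun i => \sum_(k | g k == i) c k); split.
  by move=> i; apply: sumr_ge0.
rewrite (partition_big g predT) //=; apply: eq_bigr => i _.
by rewrite scaler_suml; apply: eq_bigr => k /eqP <-; rewrite -gP.
Qed.

Lemma subset_conic_hull S : S `<=` conic_hull S.
Proof.
move=> x Sx; exists 1%N, (fun=> 1), (fun=> x); split=> //.
by rewrite big_ord1 scale1r.
Qed.

Lemma subset_aff_hull S : S `<=` aff_hull S.
Proof.
move=> x Sx; exists 1%N, (fun=> 1), (fun=> x); split=> //.
  by rewrite big_ord1.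
by rewrite big_ord1 scale1r.
Qed.

Lemma aff_hull2 S x y (t : R) : S x -> S y -> aff_hull S (t *: x + (1 - t) *: y).
Proof.
move=> Sx Sy; exists 2%N, (fun i => if i == ord0 then t else 1 - t),
  (fun i => if i == ord0 then x else y); split.
- by move=> i; case: ifP.
- by rewrite big_ord_recl big_ord1 /= addrC subrK.
- by rewrite big_ord_recl big_ord1 /=.
Qed.

(** Splitting each coordinate into positive and negative parts writes a vector of the span as a
    difference of two points of the cone. *)
Lemma dir_conic_hull n (X : n.-tuple E) :
  dir (conic_hull [set x | x \in X]) = vset <<X>>%VS.
Proof.
have sub z : aff_hull (conic_hull [set x | x \in X]) z -> z \in <<X>>%VS.
  move=> [m [c [s [sC _ ->]]]]; apply: memv_suml => k _; apply: memvZ.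
  have [l [a [t [tX _ ->]]]] := sC k.
  by apply: memv_suml => i _; apply/memvZ/memv_span/tX.
apply/seteqP; split => x /=.
  by move=> [y /sub yX [z /sub zX <-]]; rewrite /vset/= memvB.
rewrite /vset/= => /coord_span xE; pose a i := coord X i x.
exists (\sum_i Num.max (a i) 0 *: X`_i).
  apply: subset_aff_hull; rewrite conic_hull_tuple.
  by exists (fun i => Num.max (a i) 0); split=> // i; rewrite le_max lexx orbT.
exists (\sum_i Num.max (- a i) 0 *: X`_i).
  apply: subset_aff_hull; rewrite conic_hull_tuple.
  by exists (fun i => Num.max (- a i) 0); split=> // i; rewrite le_max lexx orbT.
rewrite [RHS]xE -sumrB; apply: eq_bigr => i _; rewrite -scalerBl; congr (_ *: _).
by rewrite -/(a i) !maxEle oppr_le0; case: (lerP 0 (a i)); case: (lerP (a i) 0); lra.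
Qed.

(** This extracts from a rational subspace a finite spanning family of lattice vectors. *)
Lemma lin_hull_span S (s : seq E) :
  (forall x, x \in s -> lin_hull S x) ->
  exists t : seq E, (forall x, x \in t -> S x) /\ (<< s >> <= <<t>>)%VS.
Proof.
elim: s => [|x s IH] sS; first by exists [::]; rewrite span_nil sub0v.
have [|t [tS st]] := IH; first by move=> y ys; apply: sS; rewrite inE ys orbT.
have [n [c [u [uS xE]]]] := sS x (mem_head _ _).
exists ([seq u i | i <- enum 'I_n] ++ t); split.
  by move=> y; rewrite mem_cat => /orP[/mapP[i _ ->]|/tS].
rewrite span_cons span_cat addvS // -memvE xE.
by apply: memv_suml => i _; apply/memvZ/memv_span/map_f; rewrite mem_enum.
Qed.

Lemma bounded_subset S (T : set E) : S `<=` T -> bounded T -> bounded S.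
Proof.
move=> ST [M [Mr MT]]; exists M; split=> // r Mr' _ [x Sx <-] /=.
by apply: (MT r Mr'); exists x => //; apply: ST.
Qed.

Lemma bounded_ray S x w :
  bounded S -> (forall t : R, 0 <= t -> S (x + t *: w)) -> w = 0.
Proof.
rewrite /bounded /bounded_near => -[M [Mr MP]] ray.
apply/eqP; rewrite -[_ == _]negbK; apply/negP => w0.
have w1 : 0 < `|v2r w|.
  by rewrite normr_gt0; apply: contraNneq w0 => h; rewrite -(v2rK w) h linear0.
have M1 : M < `|M| + 1 by rewrite (le_lt_trans (ler_norm M)) ?ltrDl.
(* With this [t], the vector [t *: w] is so long that subtracting the norm of [x] still leaves more
   than [|M| + 1]. *)
pose t := (`|M| + 1 + `|v2r x| + 1) / `|v2r w|.
have t0 : 0 <= t by rewrite divr_ge0 // !addr_ge0.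
suff : `|M| + 1 < `|v2r (x + t *: w)|.
  by rewrite ltNge (MP _ M1) //=; exists (x + t *: w) => //; apply: ray.
have := ler_normB (v2r (x + t *: w)) (v2r x).
rewrite -linearB /= addrC addKr linearZ normrZ ger0_norm // divfK ?gt_eqF //.
by lra.
Qed.

End Hulls.

(** The step is the inverse of a number that bounds all ratios [h i / g i] at once. *)
Lemma exists_small_step (R : realFieldType) (I : finType) (g h : I -> R) :
  (forall i, 0 < g i) -> exists2 e : R, 0 < e & forall i, e * h i <= g i.
Proof.
move=> g0; pose s := 1 + \sum_i `|h i| / g i.
have t0 i : 0 <= `|h i| / g i by rewrite divr_ge0 // ltW.
have s0 : 0 < s by rewrite ltr_wpDr ?sumr_ge0.
exists s^-1; first by rewrite invr_gt0.
move=> i; rewrite mulrC ler_pdivrMr // -ler_pdivrMl // mulrC.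
apply: (@le_trans _ _ (`|h i| / g i)).
  by rewrite ler_pM2r ?invr_gt0 ?ler_norm.
by rewrite /s (bigD1 i) //= addrA [1 + _]addrC -addrA lerDl addr_ge0 ?sumr_ge0.
Qed.

(** * Local cones, vertices and [L_space] of a system of inequalities *)

Section Polyhedron.
Variables (R : realType) (V : vectType R).
Local Notation W := 'Hom(V, R^o).
Implicit Types (x y xi eta : W) (P : set W) (N : set V).

Lemma evD x y u : (x + y) u = x u + y u :> R.
Proof. exact: add_lfunE. Qed.

Lemma evN x u : (- x) u = - x u :> R.
Proof. exact: opp_lfunE. Qed.

Lemma evB x y u : (x - y) u = x u - y u :> R.
Proof. by rewrite evD evN. Qed.

Lemma evZ (a : R) x u : (a *: x) u = a * x u :> R.
Proof. exact: scale_lfunE. Qed.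

Lemma ev_sum (J : Type) (r : seq J) (Q : pred J) (f : J -> W) u :
  (\sum_(j <- r | Q j) f j) u = \sum_(j <- r | Q j) f j u :> R.
Proof. exact: sum_lfunE. Qed.

Lemma ev_sumr (J : Type) (r : seq J) (Q : pred J) (f : J -> V) x :
  x (\sum_(j <- r | Q j) f j) = \sum_(j <- r | Q j) x (f j) :> R.
Proof. exact: linear_sum. Qed.

(** Indexing by any finite type lets two systems be joined over a sum type. *)
Definition hpoly (I : finType) (v : I -> V) (c : I -> R) : set W :=
  [set x | forall i, c i <= x (v i)].

Lemma polyhedron_overP N P :
  polyhedron_over N P <->
  exists (I : finType) (v : I -> V) (c : I -> R),
    (forall i, N (v i)) /\ P = hpoly v c.
Proof.
split=> [[n [v [c [vN PE]]]]|[I [v [c [vN ->]]]]].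
  by exists 'I_n, v, c.
exists #|I|, (v \o enum_val), (c \o enum_val); split=> [i|]; first exact: vN.
apply/seteqP; split=> x /= xP i; first exact: xP.
by rewrite -(enum_rankK i); apply: xP.
Qed.

Variables (I : finType) (v : I -> V) (c : I -> R).
Local Notation P := (hpoly v c).

Definition active eta : pred I := [pred i | eta (v i) == c i].

(** For [eta] in the polyhedron, this is the largest linear subspace of the local cone at [eta];
    [L_spaceE] identifies it with [L_space]. *)
Definition lineality eta : set W := [set x | forall i, active eta i -> x (v i) = 0].

Lemma local_cone_step eta x :
  P eta -> (forall i, active eta i -> 0 <= x (v i)) ->
  exists2 e : R, 0 < e & P (eta + e *: x).
Proof.
(* Only inequalities with positive slack limit the step; at active indices the values 1 and 0 make
   the condition vacuous. *)
move=> Pe xp; pose g i := if active eta i then 1 else eta (v i) - c i : R.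
have [|e e0 eP] :=
  @exists_small_step R I g (fun i => if active eta i then 0 else - x (v i)).
  move=> i; rewrite /g; case: ifPn => // ia.
  by rewrite subr_gt0 lt_neqAle eq_sym ia; apply: Pe.
exists e => // i; rewrite evD evZ; have := eP i; rewrite /g.
case: ifPn => ia; last by rewrite mulrN; lra.
by move=> _; rewrite (eqP ia) lerDl mulr_ge0 ?xp // ltW.
Qed.

Lemma local_coneP eta x : P eta ->
  local_cone P eta x <-> forall i, active eta i -> 0 <= x (v i).
Proof.
move=> Pe; split=> [[n [a [s [sP a0 ->]]]] i /eqP ia|xp].
  rewrite ev_sum sumr_ge0 // => k _; rewrite evZ mulr_ge0 //.
  by have [y Py <-] := sP k; rewrite evB subr_ge0 ia; apply: Py.
have [e e0 eP] := local_cone_step Pe xp.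
exists 1%N, (fun=> e^-1), (fun=> e *: x); split.
- by move=> _; exists (eta + e *: x); [exact: eP | rewrite /= addrC addKr].
- by move=> _; rewrite invr_ge0 ltW.
- by rewrite big_ord1 scalerA mulVf ?scale1r ?gt_eqF.
Qed.

Lemma local_cone_dir eta x : P eta -> local_cone P eta x -> dir P x.
Proof.
move=> Pe /(local_coneP _ Pe) /(local_cone_step Pe)[e e0 eP].
exists (eta + x); last exists eta.
(* The point [eta + x] is on the line through two points of P, hence in the affine hull. *)
- have -> : eta + x = e^-1 *: (eta + e *: x) + (1 - e^-1) *: eta.
    rewrite scalerDr scalerA mulVf ?gt_eqF // scalerBl !scale1r.
    by rewrite [RHS]addrC addrA subrK.
  exact: aff_hull2.
- exact: subset_aff_hull.
- by rewrite addrC addKr.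
Qed.

Lemma local_cone_polyhedral N eta : P eta ->
  (forall i, N (v i)) -> N 0 -> polyhedron_over N (local_cone P eta).
Proof.
move=> Pe vN N0; apply/polyhedron_overP.
(* Inactive inequalities are replaced by the trivial one with normal 0. *)
exists I, (fun i => if active eta i then v i else 0), (fun=> 0).
split=> [i|]; first by case: ifP.
apply/seteqP; split=> x /= => [/(local_coneP _ Pe) xp i|xp].
  by case: ifP => [/xp//|_]; rewrite linear0.
by apply/local_coneP => // i ia; have := xp i; rewrite ia.
Qed.

Lemma conic_hull_local_cone eta : P eta ->
  conic_hull (local_cone P eta) = local_cone P eta.
Proof.
move=> Pe; apply/seteqP; split=> x.
  move=> [n [a [s [sC a0 ->]]]]; apply/local_coneP => // i ia.
  rewrite ev_sum sumr_ge0 // => k _; rewrite evZ mulr_ge0 //.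
  by have /(local_coneP _ Pe) := sC k; apply.
exact: subset_conic_hull.
Qed.

(** The sum of the active inequalities supports the face: equality in the sum forces equality in
    every summand. *)
Lemma active_face eta : P eta ->
  is_face [set x | P x /\ forall i, active eta i -> active x i] P.
Proof.
move=> Pe; exists (\sum_(i | active eta i) v i), (\sum_(i | active eta i) c i).
split=> [x Px|]; first by rewrite ev_sumr; apply: ler_sum.
apply/seteqP; split=> x /= [Px]; rewrite ?ev_sumr => xa; split=> //.
  by apply: eq_bigr => i /xa /eqP.
have le0 i : active eta i -> 0 <= x (v i) - c i by rewrite subr_ge0.
move=> i ia; apply/eqP/subr0_eq; apply: (psumr_eq0P le0) => //.
by rewrite sumrB xa subrr.
Qed.

(** Induction on the number of inequalities not tight at [eta]. If [lineality] is zero, the face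
    given by [active_face] is the point [eta]. Otherwise a nonzero [w] in it keeps the tight
    inequalities tight, and some other one must decrease along [w], since P contains no ray. *)
Lemma exists_vertex eta : bounded P -> P eta ->
  exists xi, [/\ is_vertex xi P, P xi & forall i, active eta i -> active xi i].
Proof.
move=> Pb; have [n] := ubnP (#|I| - #|active eta|)%N.
elim: n eta => // n IH eta le Pe.
have [triv|] := pselect (forall x, lineality eta x -> x = 0).
  exists eta; split=> //; rewrite /is_vertex.
  suff -> : [set eta] = [set x | P x /\ forall i, active eta i -> active x i].
    exact: active_face.
  apply/seteqP; split=> x /= => [->//|[Px xa]].
  apply/subr0_eq/triv => i ia; rewrite evB.
  by rewrite (eqP (xa _ ia)) (eqP ia) subrr.
move=> /existsNP[w /not_implyP[wL w0]].
have [k wk] : exists k, w (v k) < 0.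
  apply: contrapT => /forallNP wP; apply: w0; apply: (bounded_ray (x := eta) Pb).
  move=> t t0 i; rewrite evD evZ (le_trans (Pe i)) // lerDl mulr_ge0 // leNgt.
  exact/negP/wP.
(* Move in the direction w up to the first inequality that becomes tight. *)
pose q i : R := (eta (v i) - c i) / - w (v i).
pose m := [arg min_(j < k | w (v j) < 0) q j]%O.
have [wm mmin] : w (v m) < 0 /\ forall j, w (v j) < 0 -> q m <= q j.
  by rewrite /m; case: arg_minP.
pose x := eta + q m *: w.
have q0 : 0 <= q m by rewrite divr_ge0 ?subr_ge0 // oppr_ge0 ltW.
have Px : P x.
  move=> i; rewrite evD evZ; case: (ltP (w (v i)) 0) => wi.
    have := mmin i wi; rewrite {2}/q ler_pdivlMr ?oppr_gt0 //; lra.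
  by rewrite (le_trans (Pe i)) // lerDl mulr_ge0.
have xa i : active eta i -> active x i.
  by move=> ia; rewrite /active/= evD evZ (wL _ ia) mulr0 addr0.
have xm : active x m.
  have wm0 : - w (v m) != 0 by rewrite oppr_eq0 lt_eqF.
  have qm : q m * - w (v m) = eta (v m) - c m by rewrite /q divfK.
  by apply/eqP; rewrite evD evZ; lra.
have em : ~~ active eta m by apply: contraTN wm => /wL ->; rewrite ltxx.
have lt_act : (#|active eta| < #|active x|)%N.
  apply/proper_card/properP; split; first exact/fintype.subsetP.
  by exists m.
have [|//|xi [xiv Pxi xia]] := IH x.
  rewrite ltnS in le; apply: leq_trans le; apply: ltn_sub2l => //.
  exact: leq_trans lt_act (max_card _).
by exists xi; split=> // i /xa /xia.
Qed.

(** Neighbourhoods in [rel_interior] are taken in coordinates, where evaluation at [u] is a linear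
    combination of the entries. *)
Lemma lfun_eval_continuous (u : V) :
  continuous (fun r : 'rV[R]_(dim W) => (r2v r : W) u : R).
Proof.
have -> : (fun r : 'rV[R]_(dim W) => (r2v r : W) u : R) =
    fun r => \sum_j r 0 j * (r2v (delta_mx 0 j) : W) u.
  apply/funext => r; rewrite {1}(row_sum_delta r) linear_sum ev_sum.
  by apply: eq_bigr => j _; rewrite linearZ evZ.
have addc : continuous (fun z : R * R => z.1 + z.2) by exact: add_continuous.
move=> r; apply: (cvg_big addc) => [|j _]; first exact: nbhs_filter.
exact: (cvgMr_tmp (@coord_continuous R _ _ 0 j r)).
Qed.

(** If F has [eta] in its relative interior, an inequality tight at [eta] holds both at [y] in F and
    at a point beyond [eta], so it is tight at [y]. Conversely, the face of [active_face] has [eta]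
    in its relative interior, because the inequalities strict at [eta] remain strict nearby. *)
Lemma L_spaceE eta : P eta -> L_space eta P = lineality eta.
Proof.
move=> Pe; apply/seteqP; split=> x.
  move=> [F [[u [d [ud FE]]] [Fe near_e]]] [n [a [s [sF ->]]]] i ia.
  rewrite ev_sum big1 // => k _; rewrite evZ.
  have [y Fy <-] := sF k.
  suff -> : (y - eta) (v i) = 0 :> R by rewrite mulr0.
  (* eta is interior, so the segment from y extends beyond eta inside F. *)
  have [e e0 Fz] : exists2 e : R, 0 < e & F (eta - e *: (y - eta)).
    pose f (t : R) := v2r eta - t *: v2r (y - eta).
    have fc : f @ (0 : R) --> v2r eta.
      have <- : v2r eta - 0 *: v2r (y - eta) = v2r eta by rewrite scale0r subr0.
      by apply: cvgB; [exact: cvg_cst | apply: cvgZr_tmp; exact: cvg_id].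
    have := fc _ near_e => /nbhs_ballP[e /= e0 eP].
    exists (e / 2); first by rewrite divr_gt0.
    have := eP (e / 2); rewrite /= /f -linearZ -linearB v2rK; apply.
      rewrite /ball /= sub0r normrN ger0_norm ?ltW ?divr_gt0 //.
      by rewrite ltr_pdivrMr // ltr_pMr // ltr1n.
    have -> : eta - (e / 2) *: (y - eta) = (- (e / 2)) *: y + (1 - - (e / 2)) *: eta.
      by rewrite scalerBr opprB opprK scaleNr scalerDl scale1r addrA [RHS]addrC.
    exact: aff_hull2.
  have PF z : F z -> P z by rewrite FE => -[].
  have := PF _ Fz i; have := PF _ Fy i.
  rewrite !(evB, evZ) (eqP ia) => h1 h2.
  apply/eqP; rewrite eq_le subr_ge0 h1 andbT -(pmulr_rle0 _ e0); lra.
move=> xL.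
exists [set x | P x /\ forall i, active eta i -> active x i].
  split; first exact: active_face.
  split=> //=.
  have near_in : \forall r \near v2r eta,
      forall i, ~~ active eta i -> c i < (r2v r : W) (v i).
    have nearI (Q : I -> 'rV[R]_(dim W) -> Prop) :
        (forall i, \forall r \near v2r eta, Q i r) ->
        \forall r \near v2r eta, forall i, Q i r.
      move=> nQ; have : \forall r \near v2r eta, forall i, i \in enum I -> Q i r.
        elim: (enum I) => [|j s IH]; first by near=> r.
        near=> r => i; rewrite inE => /predU1P[->|].
          by near: r; exact: nQ.
        by move: i; near: r; exact: IH.
      by apply: filterS => r rQ i; apply: rQ; rewrite mem_enum.
    apply: nearI => i; have [ia|ia] := boolP (active eta i); first by near=> r.
    have lt_e : c i < (r2v (v2r eta) : W) (v i).
      by rewrite v2rK lt_neqAle eq_sym ia; apply: Pe.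
    near=> r => _; near: r.
    exact: (@lfun_eval_continuous (v i) (v2r eta) _ (lt_nbhsr lt_e)).
  near=> r => -[n [a [s [sF a1 rE]]]].
  (* Equations that hold on a set pass to its affine combinations. *)
  have ra i : active eta i -> active (r2v r) i.
    move=> ia; apply/eqP; rewrite rE ev_sum -[RHS]mul1r -a1 mulr_suml.
    by apply: eq_bigr => k _; rewrite evZ; have [_ /(_ _ ia)/eqP->] := sF k.
  split=> // i; have [/ra/eqP->//|ia] := boolP (active eta i).
  by apply: ltW; move: i ia; near: r.
have [|e e0 eP] := @local_cone_step eta x Pe.
  by move=> i /xL ->.
exists 1%N, (fun=> e^-1), (fun=> e *: x); split.
  move=> _; exists (eta + e *: x); last by rewrite /= addrC addKr.
  split=> // i ia; rewrite /active /= evD evZ (xL _ ia) mulr0 addr0.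
  exact: ia.
by rewrite big_ord1 scalerA mulVf ?scale1r ?gt_eqF.
Unshelve. all: by end_near.
Qed.

End Polyhedron.

(** * Polyhedra with normals in a prescribed set *)

Section PolyhedronOver.
Variables (R : realType) (V : vectType R) (N : set V).
Implicit Types (P Q : set 'Hom(V, R^o)).

Lemma polyhedron_overI P Q :
  polyhedron_over N P -> polyhedron_over N Q -> polyhedron_over N (P `&` Q).
Proof.
move=> /polyhedron_overP[I [v [c [vN ->]]]] /polyhedron_overP[J [w [d [wN ->]]]].
apply/polyhedron_overP; exists (I + J)%type,
  (fun i => match i with inl i => v i | inr j => w j end),
  (fun i => match i with inl i => c i | inr j => d j end).
split=> [[]//|]; apply/seteqP; split=> x /= => [[xP xQ] []//|xPQ].
by split=> i; [exact: (xPQ (inl i)) | exact: (xPQ (inr i))].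
Qed.

Lemma polyhedron_over_local_cone P eta :
  N 0 -> polyhedron_over N P -> P eta -> polyhedron_over N (local_cone P eta).
Proof.
move=> N0 /polyhedron_overP[I [v [c [vN ->]]]] Pe.
exact: local_cone_polyhedral.
Qed.

Lemma polyhedral_local_cone P eta :
  is_polyhedron P -> P eta -> polyhedral_cone (local_cone P eta).
Proof.
move=> /polyhedron_overP[I [v [c [_ ->]]]] Pe.
by split; [exact: local_cone_polyhedral | exact: conic_hull_local_cone].
Qed.

Lemma vertex_mem P xi : is_vertex xi P -> P xi.
Proof.
move=> [u [d [_ xE]]]; have : [set xi] xi by [].
by rewrite xE => -[].
Qed.

End PolyhedronOver.

(** * The local cone of a slice at one of its vertices *)

Section Slice.
Variables (R : realType) (V : vectType R).
Local Notation W := 'Hom(V, R^o).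
Variables (I : finType) (v : I -> V) (c : I -> R).
Local Notation P := (hpoly v c).
Variables (A : set W) (B : {vspace W}).
Hypothesis AB : is_affine A B.
Variables (eta : W).
Hypotheses (Ae : A eta) (Pe : P eta).
Local Notation L := (lineality v c eta).

Lemma affineE : A = [set x | x - eta \in B].
Proof.
have [a AE] := AB; move: Ae; rewrite AE /= => aB.
apply/seteqP; split=> x /= xB; first by rewrite -(subrKA a) -[a - _]opprB rpredB.
by rewrite -(subrKA eta) rpredD.
Qed.

Lemma local_cone_slice : local_cone (A `&` P) eta = vset B `&` local_cone P eta.
Proof.
apply/seteqP; split=> x.
  move=> [n [a [s [sAP a0 ->]]]]; split.
    apply: memv_suml => k _; apply: memvZ.
    by have [y [Ay _] <-] := sAP k; move: Ay; rewrite affineE.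
  exists n, a, s; split=> // k.
  by have [y [_ Py] <-] := sAP k; exists y.
move=> [xB /(local_coneP _ Pe) xp].
have [e e0 eP] := local_cone_step Pe xp.
exists 1%N, (fun=> e^-1), (fun=> e *: x); split.
- move=> _; exists (eta + e *: x); last by rewrite /= addrC addKr.
  by split=> //; rewrite affineE /= addrC addKr memvZ.
- by move=> _; rewrite invr_ge0 ltW.
- by rewrite big_ord1 scalerA mulVf ?scale1r ?gt_eqF.
Qed.

Lemma linealityN x : L x -> L (- x).
Proof. by move=> xL i ia; rewrite evN xL // oppr0. Qed.

Lemma lineality_sum (J : finType) (Q : pred J) (a : J -> R) (f : J -> W) :
  (forall j, Q j -> L (f j)) -> L (\sum_(j | Q j) a j *: f j).
Proof.
by move=> fL i ia; rewrite ev_sum big1 // => j Qj; rewrite evZ fL ?mulr0.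
Qed.

(** From [eta] one can move a little along both [x] and [- x] inside the slice. The functional [u]
    exposing [eta] therefore vanishes on [x], so the moved point lies in the face, which is [eta]
    alone. *)
Lemma vertex_slice_lineality x :
  is_vertex eta (A `&` P) -> x \in B -> L x -> x = 0.
Proof.
move=> [u [d [ud ue]]] xB xL.
have step y : y \in B -> L y -> exists2 e : R, 0 < e & (A `&` P) (eta + e *: y).
  move=> yB yL; have [|e e0 eP] := @local_cone_step _ _ _ v c eta y Pe.
    by move=> i /yL ->.
  exists e => //; split=> //; rewrite affineE /= [_ + e *: _]addrC addrK memvZ //.
have ed : eta u = d.
  have : [set eta] eta by [].
  by rewrite ue => -[].
have [e1 e10 AP1] := step x xB xL.
have [e2 e20 AP2] := step (- x) (etrans (memvN B x) xB) (linealityN xL).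
have xu : x u = 0 :> R.
  have := ud _ AP1; have := ud _ AP2; rewrite !(evD, evZ, evN) ed.
  rewrite !lerDl mulrN oppr_ge0 pmulr_rle0 // pmulr_rge0 // => h1 h2.
  by apply/eqP; rewrite eq_le h1.
have : [set eta] (eta + e1 *: x).
  by rewrite ue; split=> //; rewrite evD evZ xu mulr0 addr0.
move=> /= /(congr1 (fun z => - eta + z)); rewrite addKr addNr => /eqP.
by rewrite scaler_eq0 gt_eqF //= => /eqP.
Qed.

Variables (xi : W) (n : nat) (e : n.-tuple W).
Hypotheses (Px : P xi) (act_sub : forall i, active v c eta i -> active v c xi i)
  (coneE : local_cone P xi = conic_hull [set x | x \in e]).

Lemma generator_ge0 (j : 'I_n) i : active v c eta i -> 0 <= e`_j (v i).
Proof.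
move=> ia; have : local_cone P xi e`_j.
  by rewrite coneE; apply/subset_conic_hull/mem_nth; rewrite size_tuple.
by move/(local_coneP _ Px); apply; apply: act_sub.
Qed.

(** Expand [eta + r *: x - xi] and [eta - xi] with non-negative coefficients and subtract: a
    negative coefficient can arise only at a generator that occurs in [eta - xi], and such a
    generator lies in L. *)
Lemma local_cone_gen x :
  local_cone P eta x <->
  exists d : 'I_n -> R, (forall j : 'I_n, ~ L e`_j -> 0 <= d j) /\ x = \sum_j d j *: e`_j.
Proof.
have translate_cone y : P y -> exists d : 'I_n -> R,
    (forall j, 0 <= d j) /\ y - xi = \sum_j d j *: e`_j.
  move=> Py; have : local_cone P xi (y - xi).
    by apply/(local_coneP _ Px) => i /eqP ia; rewrite evB ia subr_ge0; apply: Py.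
  by rewrite coneE conic_hull_tuple.
split.
  move=> /(local_coneP _ Pe) /(local_cone_step Pe)[r r0 rP].
  have [p [p0 pE]] := translate_cone _ rP.
  have [t [t0 tE]] := translate_cone _ Pe.
  (* Inequalities active at eta are active at xi, hence vanish on eta - xi,
     and so on each e`_j occurring in it. *)
  have tL (j : 'I_n) : ~ L e`_j -> t j = 0.
    move=> NL; apply/eqP/negP => /negP tj; apply: NL => i ia.
    have tp k : true -> 0 <= t k * e`_k (v i).
      by move=> _; rewrite mulr_ge0 // generator_ge0.
    have : (eta - xi) (v i) = 0 :> R.
      by rewrite evB (eqP ia) (eqP (act_sub ia)) subrr.
    rewrite tE ev_sum; under eq_bigr do rewrite evZ.
    move=> /(psumr_eq0P tp) /(_ j isT) /eqP.
    by rewrite mulf_eq0 (negPf tj) => /eqP.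
  exists (fun j => r^-1 * (p j - t j)); split.
    by move=> j /tL ->; rewrite subr0 mulr_ge0 // invr_ge0 ltW.
  under eq_bigr do rewrite -scalerA; rewrite -scaler_sumr.
  under eq_bigr do rewrite scalerBl; rewrite sumrB -pE -tE.
  rewrite opprB addrA subrK [_ + r *: x]addrC addrK.
  by rewrite scalerA mulVf ?scale1r ?gt_eqF.
move=> [d [d0 ->]]; apply/(local_coneP _ Pe) => i ia.
rewrite ev_sum sumr_ge0 // => j _; rewrite evZ.
have [jL|jL] := pselect (L e`_j); first by rewrite (jL i ia) mulr0.
by rewrite mulr_ge0 ?d0 ?generator_ge0.
Qed.

(** On an active normal, every term of the expansion from [local_cone_gen] is non-negative and the
    total is 0, so every term vanishes. *)
Lemma lineality_gen x : L x ->
  exists d : 'I_n -> R, (forall j : 'I_n, ~ L e`_j -> d j = 0) /\ x = \sum_j d j *: e`_j.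
Proof.
move=> xL; have /local_cone_gen[d [d0 xE]] : local_cone P eta x.
  by apply/(local_coneP _ Pe) => i /xL ->.
exists d; split=> // j NL; apply: contrapT => /eqP dj; apply: NL => i ia.
have := xL i ia; rewrite xE ev_sum; under eq_bigr do rewrite evZ.
have tp k : true -> 0 <= d k * e`_k (v i).
  move=> _; have [kL|kL] := pselect (L e`_k); first by rewrite (kL i ia) mulr0.
  by rewrite mulr_ge0 ?d0 ?generator_ge0.
move=> /(psumr_eq0P tp) /(_ j isT) /eqP.
by rewrite mulf_eq0 (negPf dj) => /eqP.
Qed.

Hypothesis ve : is_vertex eta (A `&` P).
Variable b : 'I_n -> W.
Hypotheses (bB : forall j, b j \in B) (bL : forall j : 'I_n, L (e`_j - b j)).

Definition transverse_index : {set 'I_n} := [set j : 'I_n | `[< ~ L e`_j >]].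
Local Notation J := transverse_index.

Lemma mem_transverse_index (j : 'I_n) : reflect (~ L e`_j) (j \in J).
Proof. by rewrite inE; apply: asboolP. Qed.

Lemma notin_transverse_index (j : 'I_n) : j \notin J -> L e`_j.
Proof. by move=> /mem_transverse_index; apply: contrapT. Qed.

Definition slice_gen : #|J|.-tuple W := [tuple b (enum_val k) | k < #|J|].

Lemma slice_genE (k : 'I_#|J|) : slice_gen`_k = b (enum_val k).
Proof. by rewrite -(tnth_nth 0) tnth_mktuple. Qed.

Lemma sum_slice_gen (d : 'I_n -> R) :
  \sum_(k < #|J|) d (enum_val k) *: slice_gen`_k = \sum_j d j *: b j.
Proof.
rewrite (bigID (mem J)) /= [X in _ + X]big1 => [|j jJ]; last first.
  (* Outside J, both [e_j] and [e_j - b j] lie in L, hence so does [b j], which is also in B. *)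
  suff -> : b j = 0 by rewrite scaler0.
  apply: (vertex_slice_lineality ve) => // i ia.
  rewrite -[b j]opprK -[- b j](addKr e`_j) opprD opprK evB bL //.
  by rewrite (notin_transverse_index jJ) // subrr.
by rewrite addr0 [RHS]big_enum_val; apply: eq_bigr => k _; rewrite slice_genE.
Qed.

(** The difference of the two sums lies in B, and it lies in L as a combination of the [e_j - b j];
    at a vertex of the slice it must vanish. *)
Lemma slice_expansion (d : 'I_n -> R) :
  \sum_j d j *: e`_j \in B -> \sum_j d j *: e`_j = \sum_j d j *: b j.
Proof.
move=> dB; apply/subr0_eq/(vertex_slice_lineality ve).
  by apply: rpredB => //; apply: memv_suml => j _; apply: memvZ.
rewrite -sumrB; under eq_bigr do rewrite -scalerBr.
exact: lineality_sum.
Qed.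

Lemma slice_gen_local_cone (k : 'I_#|J|) :
  (vset B `&` local_cone P eta) slice_gen`_k.
Proof.
rewrite slice_genE; split; first exact: bB.
apply/(local_coneP _ Pe) => i ia; set j := enum_val k.
(* On active normals [b j] takes the same values as the generator [e_j]. *)
have := bL j ia; rewrite evB => /subr0_eq <-.
exact: generator_ge0.
Qed.

Lemma local_cone_slice_gen :
  local_cone (A `&` P) eta = conic_hull [set x | x \in slice_gen].
Proof.
rewrite local_cone_slice conic_hull_tuple; apply/seteqP; split=> x /=.
  move=> [xB /local_cone_gen[d [d0 xE]]].
  exists (d \o enum_val); split.
    by move=> k; apply/d0/mem_transverse_index/enum_valP.
  by rewrite sum_slice_gen xE; apply: slice_expansion; rewrite -xE.
move=> [d [d0 ->]]; split.
  by apply: memv_suml => k _; apply: memvZ; case: (slice_gen_local_cone k).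
apply/(local_coneP _ Pe) => i ia; rewrite ev_sum sumr_ge0 // => k _.
rewrite evZ mulr_ge0 //; have [_ /(local_coneP _ Pe)] := slice_gen_local_cone k.
exact.
Qed.

(** A relation among the [b j] with j in J puts the same combination of the [e_j] into L. By
    [lineality_gen] it is then also a combination of generators outside J, and freeness of [e] kills
    its coefficients. *)
Lemma free_slice_gen : free e -> free slice_gen.
Proof.
move=> /freeP efree; apply/freeP => d dE.
(* This extends [d] from the enumeration of J to all indices, by zero. *)
pose D (j : 'I_n) := \sum_(k < #|J| | enum_val k == j) d k.
have Dd k : D (enum_val k) = d k.
  rewrite /D (big_pred1 k) // => l.
  by apply/eqP/eqP => [/enum_val_inj|->].
have : L (\sum_(j in J) D j *: e`_j).
  have -> : \sum_(j in J) D j *: e`_j = \sum_(j in J) D j *: (e`_j - b j).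
    under [RHS]eq_bigr do rewrite scalerBr; rewrite sumrB.
    suff -> : \sum_(j in J) D j *: b j = 0 by rewrite subr0.
    rewrite -[RHS]dE [LHS]big_enum_val; apply: eq_bigr => k _.
    by rewrite Dd slice_genE.
  by apply: lineality_sum.
move=> /lineality_gen[d' [d'0 DE]] k.
have jJ : enum_val k \in J by exact: enum_valP.
have := efree (fun j => (if j \in J then D j else 0) - d' j) _ (enum_val k).
rewrite jJ Dd d'0 ?subr0; last exact/mem_transverse_index.
apply; under eq_bigr do rewrite scalerBl; rewrite sumrB -DE.
rewrite [X in _ - X]big_mkcond /=; apply/eqP; rewrite subr_eq0; apply/eqP.
by apply: eq_bigr => j _; case: ifP; rewrite ?scale0r.
Qed.

(** Passing from [e] to the slice generators keeps the coefficients, hence their integrality. *)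
Lemma sub_slice_gen_int (a : 'I_n -> int) x :
  x \in B -> x = \sum_(j < n) e`_j *~ a j -> inIntSpan slice_gen x.
Proof.
move=> xB xE; exists [ffun k => a (enum_val k)].
have xE' : x = \sum_j (a j)%:~R *: e`_j.
  by rewrite xE; apply: eq_bigr => j _; rewrite scaler_int.
rewrite xE' slice_expansion -?xE' // -sum_slice_gen.
by apply: eq_bigr => k _; rewrite ffunE scaler_int.
Qed.

End Slice.

(** * Integer matrices over the reals *)

Lemma common_denominator (I : finType) (f : I -> rat) :
  exists (d : int) (a : I -> int), d != 0 /\ forall i, d%:~R * f i = (a i)%:~R.
Proof.
exists (\prod_i denq (f i)), (fun i => (\prod_(j | j != i) denq (f j)) * numq (f i)).
split=> [|i]; first by apply/prodf_neq0 => i _; rewrite denq_neq0.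
by rewrite (bigD1 i) //= !intrM numqE; ring.
Qed.

Section IntegerMatrix.
Variables (R : realType) (m n : nat) (M : 'M[R]_(m, n)).
Hypothesis Mint : forall i j, M i j \is a Num.int.

(** Passing through the field [rat] is useful because rank and cokernel commute with field
    morphisms. *)
Lemma int_matrix_ratr :
  exists Mz : 'M[int]_(m, n), M = map_mx ratr (map_mx intr Mz : 'M[rat]_(m, n)).
Proof.
exists (\matrix_(i, j) Num.floor (M i j)); apply/matrixP => i j.
by rewrite !mxE ratr_int floorK.
Qed.

Lemma cokermx_int :
  exists2 d : int, d != 0 & forall i j, d%:~R * cokermx M i j \is a Num.int.
Proof.
have [Mz ->] := int_matrix_ratr; rewrite -map_cokermx.
set C := cokermx _; have [d [a [d0 dC]]] :=
  common_denominator (fun ij : 'I_n * 'I_n => C ij.1 ij.2).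
exists d => // i j; rewrite mxE -(ratr_int R d) -rmorphM /= (dC (i, j)) ratr_int.
exact: intr_int.
Qed.

(** If the rows were dependent, the kernel would contain a nonzero rational vector; clearing its
    denominators gives a nontrivial integer relation. *)
Lemma int_row_free :
  (forall a : 'I_m -> int, (forall j, \sum_i (a i)%:~R * M i j = 0) ->
     forall i, a i = 0) -> row_free M.
Proof.
have [Mz ME] := int_matrix_ratr; rewrite ME row_free_map => Zfree.
rewrite -kermx_eq0; apply/negPn/negP => /rowV0Pn[u /sub_kermxP uM u0].
have [d [a [d0 da]]] := common_denominator (fun i => u 0 i).
case/negP: u0; apply/eqP/rowP => i; rewrite mxE.
suff ai : a i = 0.
  by apply: (mulfI (x := d%:~R)); rewrite ?intr_eq0 // da ai mulr0.
apply: Zfree => j; have /matrixP/(_ 0 j) := uM; rewrite !mxE.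
move=> /(congr1 (fun q : rat => ratr (d%:~R * q) : R)); rewrite mulr0 rmorph0.
apply: etrans; rewrite mulr_sumr rmorph_sum /=; apply: eq_bigr => k _.
by rewrite mulrA rmorphM /= da ratr_int !mxE.
Qed.

End IntegerMatrix.

Lemma inIntSpan_nth (V : zmodType) m (t : m.-tuple V) (k : 'I_m) :
  inIntSpan t t`_k.
Proof.
exists [ffun j => (j == k)%:Z].
rewrite (bigD1 k) //= ffunE eqxx mulr1z big1 ?addr0 // => j /negPf jk.
by rewrite ffunE jk mulr0z.
Qed.

(** * Equations of subspaces in the coordinates of a basis *)

Section Coordinates.
Variables (R : realType) (V : vectType R) (n : nat) (X : n.-tuple V).
Local Notation W := 'Hom(V, R^o).
Hypothesis Xbasis : basis_of fullv X.

(** These are the coordinates of [x] in the basis dual to [X]. *)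
Definition eval_row (x : W) : 'rV[R]_n := \row_(i < n) x X`_i.

Lemma eval_row_sum m (t : 'I_m -> W) (a : 'I_m -> R) :
  eval_row (\sum_k a k *: t k) = (\row_(k < m) a k) *m \matrix_(k < m) eval_row (t k).
Proof.
apply/rowP => i; rewrite !mxE ev_sum; apply: eq_bigr => k _.
by rewrite evZ !mxE.
Qed.

Lemma eval_row_inj : injective eval_row.
Proof.
move=> x y /rowP xy; apply/lfunP => u.
rewrite (coord_basis Xbasis (memvf u)) !linear_sum; apply: eq_bigr => i _.
by rewrite !linearZ; congr (_ *: _); have := xy i; rewrite !mxE.
Qed.

Lemma mem_span_eval_row m (t : m.-tuple W) x :
  (x \in <<t>>%VS) = (eval_row x <= \matrix_(k < m) eval_row t`_k)%MS.
Proof.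
apply/idP/submxP => [/coord_span ->|[D xD]].
  by exists (\row_(k < m) coord t k x); rewrite eval_row_sum.
suff -> : x = \sum_(k < m) D 0 k *: t`_k.
  by apply: memv_suml => k _; rewrite memvZ ?memv_span ?mem_nth ?size_tuple.
apply: eval_row_inj; rewrite eval_row_sum xD; congr (_ *m _).
by apply/rowP => k; rewrite !mxE.
Qed.

(** The columns of the cokernel, read as vectors of V in the basis [X], cut out the span. The factor
    [d] serves to clear denominators. *)
Lemma mem_span_annihilator m (t : m.-tuple W) (d : R) x : d != 0 ->
  x \in <<t>>%VS <-> forall j,
    x (\sum_(i < n) (d * cokermx (\matrix_(k < m) eval_row t`_k) i j) *: X`_i) = 0 :> R.
Proof.
move=> d0; rewrite mem_span_eval_row submxE; move: (cokermx _) => C.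
have evC j : x (\sum_(i < n) (d * C i j) *: X`_i) = d * (eval_row x *m C) 0 j :> R.
  rewrite linear_sum mxE mulr_sumr; apply: eq_bigr => i _.
  by rewrite linearZ mxE -[LHS]/(d * C i j * x X`_i) -mulrA [C i j * _]mulrC.
split=> [/eqP xC j|xC]; first by rewrite evC xC mxE mulr0.
apply/eqP/rowP => j; rewrite [RHS]mxE; have /eqP := xC j.
by rewrite evC mulf_eq0 (negPf d0) => /eqP.
Qed.

Lemma affine_polyhedron (N : set V) (A : set W) m (t : m.-tuple W) (d : R) :
  is_affine A <<t>>%VS -> d != 0 -> (forall u, N u -> N (- u)) ->
  (forall j, N (\sum_(i < n)
     (d * cokermx (\matrix_(k < m) eval_row t`_k) i j) *: X`_i)) ->
  polyhedron_over N A.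
Proof.
move=> [a AE] d0 NN Nw; pose w j : V :=
  \sum_(i < n) (d * cokermx (\matrix_(k < m) eval_row t`_k) i j) *: X`_i.
(* Each equation becomes a pair of opposite inequalities. *)
apply/polyhedron_overP; exists ('I_n + 'I_n)%type,
  (fun i => match i with inl j => w j | inr j => - w j end),
  (fun i => match i with inl j => a (w j) | inr j => - a (w j) end).
split=> [[j|j]|]; [exact: Nw | exact/NN/Nw |].
rewrite AE; apply/seteqP; split=> x /=.
  move=> /(mem_span_annihilator _ _ d0) xw.
  have xaw j : x (w j) = a (w j) :> R by apply/subr0_eq; rewrite -evB; exact: xw.
  by move=> [] j /=; rewrite ?linearN /= xaw.
move=> xw; apply/(mem_span_annihilator _ _ d0) => j; rewrite evB -/(w j).
apply/eqP; rewrite subr_eq0 eq_le (xw (inl j)) andbT.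
by have := xw (inr j); rewrite /= linearN lerN2.
Qed.

End Coordinates.

Lemma affine_is_polyhedron (R : realType) (V : vectType R)
    (A : set 'Hom(V, R^o)) B : is_affine A B -> is_polyhedron A.
Proof.
rewrite -(span_basis (vbasisP B)) => AB.
exact: (affine_polyhedron (vbasisP fullv) AB (oner_neq0 R)).
Qed.

(** * Rationality and freeness from the lattice *)

Section Lattice.
Variables (R : realType) (V : vectType R) (gZ : set V).
Local Notation W := 'Hom(V, R^o).
Local Notation Lambda := (dual_lattice gZ).
Hypothesis gZL : is_lattice gZ.

Lemma lattice0 : gZ 0.
Proof.
have [n [X [_ ->]]] := gZL; exists [ffun=> 0].
by rewrite big1 // => i _; rewrite ffunE mulr0z.
Qed.

(** B is spanned by finitely many dual lattice vectors. Their values on a lattice basis form an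
    integer matrix, so by [cokermx_int] a multiple of its cokernel provides normals in the
    lattice. *)
Lemma affine_is_rational (A : set W) B :
  is_affine A B -> rational_subspace gZ B -> is_rational gZ A.
Proof.
move=> AB BQ; have [n [X [Xb gZE]]] := gZL.
have [|s [sL Bs]] := @lin_hull_span R _ (vset B `&` Lambda) (vbasis B).
  by move=> x xB; rewrite -BQ; apply: vbasis_mem.
have BE : B = <<in_tuple s>>%VS.
  apply/eqP; rewrite eqEsubv -{1}(span_basis (vbasisP B)) Bs /=.
  by apply/span_subvP => x /sL[].
have [|d d0 dC] := @cokermx_int R _ _ (\matrix_(k < size s) eval_row X (in_tuple s)`_k).
  move=> k j; rewrite !mxE; have [|_] := sL (in_tuple s)`_k.
    by rewrite mem_nth // size_tuple.
  by apply; rewrite gZE; apply: inIntSpan_nth.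
apply: (@affine_polyhedron _ _ _ _ Xb gZ A _ (in_tuple s) d%:~R).
- by rewrite -BE.
- by rewrite intr_eq0.
- rewrite gZE => u [a ->]; exists [ffun i => - a i].
  by rewrite -sumrN; apply: eq_bigr => i _; rewrite ffunE mulrNz.
- move=> j; rewrite gZE; have /choice[a aE] i := intrP (dC i j).
  exists [ffun i => a i]; apply: eq_bigr => i _.
  by rewrite aE ffunE scaler_int.
Qed.

Lemma dual_lattice_span m (t : m.-tuple W) (a : 'I_m -> int) :
  (forall k : 'I_m, Lambda t`_k) -> Lambda (\sum_(k < m) t`_k *~ a k).
Proof.
move=> tL u gu; rewrite ev_sum; apply: rpred_sum => k _.
rewrite -scaler_int evZ; apply: rpredM; first exact: intr_int.
exact: tL.
Qed.

(** The values on a lattice basis form an integer matrix whose integer row relations are those of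
    [t], so [int_row_free] applies. *)
Lemma Zbasis_free m (t : m.-tuple W) M :
  (forall k : 'I_m, Lambda t`_k) -> is_Zbasis t M -> free t.
Proof.
move=> tL [_ tZ]; have [n [X [Xb gZE]]] := gZL.
have : row_free (\matrix_(k < m) eval_row X t`_k).
  apply: int_row_free => [k i|a aE].
    by rewrite !mxE; apply: tL; rewrite gZE; apply: inIntSpan_nth.
  apply: tZ; apply: (eval_row_inj Xb); apply/rowP => i.
  rewrite !mxE ev_sum lfunE -[RHS](aE i); apply: eq_bigr => k _.
  by rewrite -scaler_int evZ !mxE.
move=> tfree; apply/freeP => a a0 k.
have : (\row_(k < m) a k) *m (\matrix_(k < m) eval_row X t`_k) = 0.
  by rewrite -eval_row_sum a0; apply/rowP => i; rewrite !mxE lfunE.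
by move=> /eqP; rewrite mulmx_free_eq0 // => /eqP/rowP/(_ k); rewrite !mxE.
Qed.

End Lattice.

(** * Slices of simple and of unimodular polytopes *)

Lemma simple_slice (R : realType) (V : vectType R)
    (Delta A : set 'Hom(V, R^o)) (B : {vspace 'Hom(V, R^o)}) :
  is_affine A B -> simple_polytope Delta -> relatively_transverse A B Delta ->
  simple_polytope (A `&` Delta).
Proof.
move=> AB [[Dpoly Dbd] Dsimple] trans.
have ADpoly : is_polyhedron (A `&` Delta).
  by apply: polyhedron_overI => //; apply: affine_is_polyhedron AB.
split; first by split=> //; apply: bounded_subset Dbd; apply: subIsetr.
move=> eta etav; have [Aeta Deta] := vertex_mem etav.
split; first exact: polyhedral_local_cone.
have /polyhedron_overP[I [v [c [_ DE]]]] := Dpoly; subst Delta.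
have [xi [xiv Dxi act]] := exists_vertex Dbd Deta.
have [_ [U [s [_ sU coneE]]]] := Dsimple _ xiv.
have efree : free (in_tuple s) by case/andP: sU.
(* Each generator of the cone at [xi] lies in [dir] of the polytope, so transversality at [eta]
   splits it. *)
have /choice[b bP] : forall j : 'I_(size s), exists b,
    b \in B /\ lineality v c eta ((in_tuple s)`_j - b).
  move=> j; have : addset (vset B) (dir (hpoly v c)) (in_tuple s)`_j.
    exists 0; first exact: mem0v.
    exists (in_tuple s)`_j; last by rewrite add0r.
    apply: (local_cone_dir Dxi); rewrite coneE.
    exact/subset_conic_hull/mem_nth.
  rewrite -(trans eta) // => -[b bB [l]]; rewrite L_spaceE // => lL <-.
  by exists b; split=> //; rewrite addrC addKr.
have bB j := proj1 (bP j); have bL j := proj2 (bP j).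
pose X := slice_gen v c eta (in_tuple s) b.
have XE : local_cone (A `&` hpoly v c) eta = conic_hull [set x | x \in X].
  exact: (local_cone_slice_gen (e := in_tuple s) AB Aeta Deta Dxi act coneE etav bB bL).
exists <<X>>%VS, X; split=> //; first by rewrite XE dir_conic_hull.
by rewrite /basis_of eqxx (free_slice_gen (e := in_tuple s) Deta Dxi act coneE bL efree).
Qed.

Lemma unimodular_slice (R : realType) (V : vectType R) (gZ : set V)
    (Delta A : set 'Hom(V, R^o)) (B : {vspace 'Hom(V, R^o)}) :
  is_lattice gZ -> is_affine A B ->
  unimodular_polytope gZ Delta -> integrally_transverse gZ A B Delta ->
  unimodular_polytope gZ (A `&` Delta).
Proof.
move=> gZL AB [[Dpoly Dbd] Drat Duni] [_ BQ trans].
have ADpoly : is_polyhedron (A `&` Delta).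
  by apply: polyhedron_overI => //; apply: affine_is_polyhedron AB.
have ADrat : is_rational gZ (A `&` Delta).
  by apply: polyhedron_overI => //; apply: affine_is_rational AB BQ.
split=> //; first by split=> //; apply: bounded_subset Dbd; apply: subIsetr.
move=> eta etav; have [Aeta Deta] := vertex_mem etav.
split; first exact: polyhedral_local_cone.
  by apply: polyhedron_over_local_cone => //; exact: lattice0.
have /polyhedron_overP[I [v [c [_ DE]]]] := Dpoly; subst Delta.
have [xi [xiv Dxi act]] := exists_vertex Dbd Deta.
have [_ _ [n [e [eZ coneE]]]] := Duni _ xiv.
have eL (j : 'I_n) : dual_lattice gZ e`_j.
  suff [] : (dual_lattice gZ `&` dir (local_cone (hpoly v c) xi)) e`_j by [].
  by rewrite (proj1 eZ); apply: inIntSpan_nth.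
have efree := Zbasis_free gZL eL eZ.
have /choice[b bP] : forall j : 'I_n, exists b,
    [/\ b \in B, dual_lattice gZ b & lineality v c eta (e`_j - b)].
  move=> j; have : addset (vset B `&` dual_lattice gZ)
      (dir (hpoly v c) `&` dual_lattice gZ) e`_j.
    exists 0; first by split; [exact: mem0v | move=> u _; rewrite lfunE rpred0].
    exists e`_j; last by rewrite add0r.
    split=> //; apply: (local_cone_dir Dxi); rewrite coneE.
    by apply/subset_conic_hull/mem_nth; rewrite size_tuple.
  rewrite -(trans eta) // => -[b [bB bLam] [l]]; rewrite L_spaceE // => -[lL _] <-.
  by exists b; split=> //; rewrite addrC addKr.
have bB j : b j \in B by case: (bP j).
have bLam j : dual_lattice gZ (b j) by case: (bP j).
have bL (j : 'I_n) : lineality v c eta (e`_j - b j) by case: (bP j).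
pose X := slice_gen v c eta e b.
have XE : local_cone (A `&` hpoly v c) eta = conic_hull [set x | x \in X].
  exact: (local_cone_slice_gen (e := e) AB Aeta Deta Dxi act coneE etav bB bL).
have XLam (k : 'I_#|transverse_index v c eta e|) : dual_lattice gZ X`_k.
  by rewrite slice_genE.
exists #|transverse_index v c eta e|, X; split=> //; split; last first.
  have /freeP Xfree : free X.
    exact: (free_slice_gen (e := e) Deta Dxi act coneE bL efree).
  move=> a aX k; apply/eqP; rewrite -(intr_eq0 R); apply/eqP.
  apply: (Xfree (fun k => (a k)%:~R)); rewrite -[RHS]aX.
  by apply: eq_bigr => i _; rewrite scaler_int.
(* It remains to see that the dual lattice points in the span of X are exactly its integer
   combinations. *)
rewrite XE dir_conic_hull; apply/seteqP; split=> x; last first.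
  move=> [a ->]; split; first exact: dual_lattice_span.
  by apply: memv_suml => k _; rewrite rpredMz ?memv_span ?mem_nth ?size_tuple.
move=> [xLam xX].
(* The span of X lies in that of [e], because each [e_j - b j] is in L and thus a combination of
   generators. A lattice point in it then has integer coordinates in [e], which [sub_slice_gen_int]
   carries over to X. *)
have be j : b j \in <<e>>%VS.
  rewrite -[b j]opprK -[- b j](addKr e`_j) rpredN rpredD ?rpredN //.
    by rewrite memv_span // mem_nth ?size_tuple.
  have [d [_ ->]] := lineality_gen (e := e) Deta Dxi act coneE (bL j).
  by apply: memv_suml => k _; rewrite memvZ ?memv_span ?mem_nth ?size_tuple.
have Xsub (U : {vspace 'Hom(V, R^o)}) : (forall j, b j \in U) -> (<<X>> <= U)%VS.
  by move=> bU; apply/span_subvP => y /tnthP[k ->]; rewrite tnth_mktuple.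
have [a xE] : inIntSpan e x.
  rewrite -[inIntSpan e x]/([set x | inIntSpan e x] x) -(proj1 eZ); split=> //.
  by rewrite coneE dir_conic_hull; apply: subvP xX; apply: Xsub.
apply: (sub_slice_gen_int AB Aeta Deta etav bB bL _ xE).
by apply: subvP xX; apply: Xsub.
Qed.

Theorem propositionA18 (R : realType) (V : vectType R) (gZ : set V)
    (Delta A : set 'Hom(V, R^o)) (B : {vspace 'Hom(V, R^o)}) :
  is_lattice gZ ->
  is_polytope Delta ->
  is_affine A B ->
  A `&` Delta !=set0 ->
  (simple_polytope Delta -> relatively_transverse A B Delta ->
     simple_polytope (A `&` Delta)) /\
  (unimodular_polytope gZ Delta -> integrally_transverse gZ A B Delta ->
     unimodular_polytope gZ (A `&` Delta)).
Proof.
move=> gZL _ AB _; split; first exact: simple_slice.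
exact: unimodular_slice.
Qed.
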